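(* Let $n\ge2$ and let $a,b\ge 1$ be integers. There exists a bijection $\phi_n^b:\mathrm{sPF}(K_{n+1}^{a,b})\longrightarrow\mathcal{U}_n^b$ such that for all $\mathcal{P}\in\mathrm{sPF}(K_{n+1}^{a,b})$, \[ \mathrm{rsum}(\mathcal{P})+\omega(r)+1=\kappa(K_n^b,T)+\sum_{e\in E(T)}\ell(e), \] where $T=\phi_n^b(\mathcal{P})$ (with its edge labelling $\ell$ and root weight $\omega(r)$) and $r$ is the root of $T$.
   Context: $\mathbb{N}=\{0,1,2,\dots\}$, $[n]=\{1,\dots,n\}$. $K_{n+1}^{a,b}$ is the complete multigraph on $V=\{0,1,\dots,n\}$ with root $0$, having exactly $a$ edges between $0$ and each $i\in[n]$ and exactly $b$ edges between any two distinct $i,j\in[n]$. $K_n^b=K_{n+1}^{a,b}-\{0\}$ is the complete multigraph on $[n]$ with $b$ edges between any two distinct vertices. Spherical parking functions: let $R=\mathbb{K}[x_1,\dots,x_n]$ over a field $\mathbb{K}$. For an undirected loopless (multi)graph $G$ on $V$ with $a_{ij}$ edges between $i$ and $j$, and $\emptyset\ne A\subseteq[n]$, put $d_A(i)=\sum_{j\in V\setminus A}a_{ij}$ and $m_A=\prod_{i\in A}x_i^{d_A(i)}$. Let $\mathcal{M}_G=\langle m_A:\emptyset\neq A\subseteq[n]\rangle$ and $\mathcal{M}_G^{(k)}=\langle m_A:\emptyset\ne A\subseteq[n],\ |A|\le k+1\rangle$ for $0\le k\le n-1$. Then $\mathrm{sPF}(G)=\{\mathcal{P}\in\mathbb{N}^n:\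 \mathbf{x}^{\mathcal{P}}\in\mathcal{M}_G\setminus\mathcal{M}_G^{(n-2)}\}$. The genus of $G$ is $g(G)=|E(G)|-|V(G)|+1$, and $\mathrm{rsum}(\mathcal{P})=g(G)-\sum_{i\in[n]}\mathcal{P}(i)$ (here with $G=K_{n+1}^{a,b}$). A rooted labelled tree on $[n]$ is uprooted if its root is larger than all children of the root. $\mathcal{U}_n^b$ is the set of uprooted trees $T$ on $[n]$ equipped with an edge labelling $\ell:E(T)\to\{0,1,\dots,b-1\}$ and a weight $\omega(r)\in\{0,1,\dots,b-1\}$ assigned to the root $r$ of $T$. $\kappa$-number: for a rooted spanning tree $T$ of a (multi)graph $H$, $\kappa(H,T)=\sum|E(\mathrm{par}_T(i),j)|$, summed over all pairs $(i,j)$ of non-root vertices such that $i$ is an ancestor of $j$ in $T$ and $i>j$, where $\mathrm{par}_T(i)$ is the parent of $i$ and $|E(u,v)|$ is the number of edges of $H$ between $u$ and $v$. *)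

(* Defs.v *)
From HB Require Import structures.
From mathcomp Require Import all_boot all_order all_algebra.
From mathcomp.multinomials Require Import mpoly.

Set Implicit Arguments.
Unset Strict Implicit.
Unset Printing Implicit Defensive.

Import Order.TTheory GRing.Theory Num.Theory.
Local Open Scope ring_scope.

(* [G u v] is the number of edges between the vertices [u] and [v]. *)
Record multigraph (m : nat) := Multigraph {
  mult :> 'I_m -> 'I_m -> nat;
  mult_sym : forall u v, mult u v = mult v u;
  mult_loopless : forall u, mult u u = 0%N
}.

Definition nedges (m : nat) (G : multigraph m) : nat :=
  (\sum_(u < m) \sum_(v < m | (u < v)%N) G u v)%N.

Definition genus (m : nat) (G : multigraph m) : int :=
  (nedges G)%:Z - m%:Z + 1.

(* A graph on V = {0, ..., n} has vertex type 'I_n.+1 and root ord0.  The set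
   [n] of non-root vertices is represented by 'I_n: the index i : 'I_n stands
   for the vertex i.+1 = [vtx i], and this shift preserves the order. *)
Definition vtx (n : nat) (i : 'I_n) : 'I_n.+1 := lift ord0 i.

Definition complete_mult (n a b : nat) (u v : 'I_n.+1) : nat :=
  if u == v then 0%N else if (u == ord0) || (v == ord0) then a else b.

Lemma complete_mult_sym n a b (u v : 'I_n.+1) :
  complete_mult a b u v = complete_mult a b v u.
Proof. by rewrite /complete_mult eq_sym orbC. Qed.

Lemma complete_mult_loopless n a b (u : 'I_n.+1) : complete_mult a b u u = 0%N.
Proof. by rewrite /complete_mult eqxx. Qed.

Definition complete_multigraph (n a b : nat) : multigraph n.+1 :=
  Multigraph (@complete_mult_sym n a b) (@complete_mult_loopless n a b).

Definition del_root (n : nat) (G : multigraph n.+1) : multigraph n :=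
  @Multigraph n (fun i j => G (vtx i) (vtx j))
    (fun i j => mult_sym G (vtx i) (vtx j))
    (fun i => mult_loopless G (vtx i)).

(* Membership of [x] in the ideal generated by the [g i], [i \in D]. *)
Definition in_ideal (R : comNzRingType) (I : finType) (D : {pred I})
    (g : I -> R) (x : R) : Prop :=
  exists c : I -> R, x = \sum_(i in D) c i * g i.

Section SphericalParking.
Variables (K : fieldType) (n : nat) (G : multigraph n.+1).

Definition outdeg (A : {set 'I_n}) (i : 'I_n) : nat :=
  (\sum_(u in ~: [set vtx j | j in A]) G (vtx i) u)%N.

Definition mono (A : {set 'I_n}) : {mpoly K[n]} :=
  \prod_(i in A) 'X_i ^+ outdeg A i.

Definition in_M (p : {mpoly K[n]}) : Prop :=
  in_ideal [pred A : {set 'I_n} | A != set0] mono p.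

Definition in_Mk (k : nat) (p : {mpoly K[n]}) : Prop :=
  in_ideal [pred A : {set 'I_n} | (A != set0) && (#|A| <= k.+1)%N] mono p.

(* Vectors in N^n are exponent vectors; ['X_[K, P]] is the monomial x^P. *)
Definition sPF (P : 'X_{1..n}) : Prop :=
  in_M 'X_[K, P] /\ ~ in_Mk (n - 2) 'X_[K, P].

Definition rsum (P : 'X_{1..n}) : int := genus G - (\sum_(i < n) P i)%N%:Z.

End SphericalParking.

(* A rooted labelled tree is given by its root and its parent map; by convention
   the root is sent to itself. *)
Record rtree (n : nat) := RTree {
  root : 'I_n;
  par : {ffun 'I_n -> 'I_n};
  par_root : par root == root;
  par_connect : [forall i, fconnect par i root]
}.

Definition is_child (n : nat) (T : rtree n) (i j : 'I_n) : bool :=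
  (j != root T) && (par T j == i).

Definition ancestor (n : nat) (T : rtree n) (i j : 'I_n) : bool :=
  (i != j) && fconnect (par T) j i.

Definition edges (n : nat) (T : rtree n) : {set {set 'I_n}} :=
  [set [set par T i; i] | i in [set~ root T]].

Definition edge (n : nat) (T : rtree n) : finType :=
  {e : {set 'I_n} | e \in edges T}.

Definition uprooted (n : nat) (T : rtree n) : bool :=
  [forall i : 'I_n, is_child T (root T) i ==> (i < root T)%N].

Record utree (n b : nat) := UTree {
  tree :> rtree n;
  tree_uprooted : uprooted tree;
  elabel : {ffun edge tree -> 'I_b};
  rweight : 'I_b
}.

Definition kappa (n : nat) (H : multigraph n) (T : rtree n) : nat :=
  (\sum_(i < n | i != root T)
     \sum_(j < n | [&& j != root T, ancestor T i j & (j < i)%N])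
        H (par T i) j)%N.

(* Main.v *)
From mathcomp Require Import all_boot all_order all_algebra.
From mathcomp Require Import zify.
From mathcomp.multinomials Require Import mpoly.
From Stdlib Require Import Classical ClassicalEpsilon.
Require Import Defs.

(* In the complete case P is spherical exactly when P i = a + b q(i) + d(i) with
   d(i) < b and q prime: more than j entries of q are smaller than j, for every
   0 < j < n.  The digit d(i) is stored as the weight of the root, or, subtracted
   from b - 1, as the label of the edge above i, so only q and the unlabelled
   tree matter.  The root r of the tree is the largest zero of q; on the other
   vertices q is an ordinary parking function, and depth-first burning from r,
   trying larger vertices first, turns it into a tree.  An edge is either burnt,
   or wasted (these are counted by q), or never tried; the untried edges are the
   pairs (parent of i, j) with j a descendant of i and j < i.  Vertices above r
   are tried before anything burns, hence they are not children of r exactly when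
   q does not vanish there, that is, when r is the largest zero. *)

Set Implicit Arguments.
Unset Strict Implicit.
Unset Printing Implicit Defensive.

(** * Forests and parking functions *)

(* [Node v L R] is the forest whose tree of largest root [v] has [L] as the
   forest hanging below [v]; [R] collects the remaining trees. *)
Inductive forest (n : nat) := Leaf | Node of 'I_n & forest n & forest n.
Arguments Leaf {n}.

Fixpoint nodes n (F : forest n) : seq 'I_n :=
  if F is Node v L R then v :: nodes L ++ nodes R else [::].

Fixpoint tops n (F : forest n) : seq 'I_n :=
  if F is Node v L R then v :: tops R else [::].

Fixpoint decr n (F : forest n) : bool :=
  if F is Node v L R then
    [&& decr L, decr R & all (fun w : 'I_n => w < v) (tops R)]
  else true.

(* [p] is the parent given to the roots; vertices outside [F] are fixed. *)
Fixpoint fpar n (F : forest n) (p i : 'I_n) : 'I_n :=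
  if F is Node v L R then
    if i == v then p else if i \in nodes L then fpar L v i else fpar R p i
  else i.

(** The proper ancestors of [i] inside [F], topmost first; the outer parent of the roots is not
    listed. *)
Fixpoint fanc n (F : forest n) (i : 'I_n) : seq 'I_n :=
  if F is Node v L R then
    if i == v then [::]
    else if i \in nodes L then v :: fanc L i else fanc R i
  else [::].

(* Depth-first burning, trying larger vertices first: the value at [i] is the
   number of edges to [i] that are tried before the one along which [i] burns. *)
Fixpoint code n (F : forest n) (i : 'I_n) : nat :=
  if F is Node v L R then
    if i == v then 0
    else if i \in nodes L then code L i + (v < i) else code R i + (size (nodes L)).+1
  else 0.

(** Tree inversions: pairs of a vertex and a larger proper ancestor. A root outside the forest does
    not count, as in [kappa]. *)
Definition forest_inv n (F : forest n) : nat :=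
  \sum_(i <- nodes F) count (fun j : 'I_n => i < j) (fanc F i).

Definition parking (T : Type) (q : T -> nat) (s : seq T) : Prop :=
  forall k, k < size s -> k < count (fun i => q i <= k) s.

Lemma parking_ltn (T : eqType) (q : T -> nat) (s : seq T) (i : T) :
  parking q s -> i \in s -> q i < size s.
Proof.
case: s => // x s pq si.
have := pq (size s) (leqnn _).
rewrite /= ltnS => h.
have/allP/(_ i si)// : all (fun i => q i <= size s) (x :: s).
rewrite all_count eqn_leq count_size /=; exact: h.
Qed.

Lemma bin2D m k : 'C(m + k, 2) = 'C(m, 2) + 'C(k, 2) + m * k.
Proof.
elim: k => [|k IH]; first by rewrite bin0n !addn0 muln0 addn0.
by rewrite addnS !binS !bin1 IH; lia.
Qed.

Section Forests.
Variable n : nat.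
Implicit Types (F L R : forest n) (i j v p : 'I_n).

Lemma uniq_node v L R : uniq (nodes (Node v L R)) ->
  [/\ v \notin nodes L, v \notin nodes R, uniq (nodes L), uniq (nodes R)
    & forall i, i \in nodes R -> i \notin nodes L].
Proof.
rewrite /= mem_cat negb_or cat_uniq => /and3P[/andP[vL vR] uL /andP[/hasPn d uR]].
by split.
Qed.

Lemma tops_sub F i : i \in tops F -> i \in nodes F.
Proof.
elim: F => //= v L _ R IH; rewrite !inE mem_cat.
by case: eqP => //= _ /IH ->; rewrite orbT.
Qed.

Lemma fanc_sub F i j : j \in fanc F i -> j \in nodes F.
Proof.
elim: F => //= v L IHL R IHR.
rewrite inE mem_cat; case: eqP => // _; case: ifP => _; rewrite ?inE.
  by case/orP=> [->//|/IHL ->]; rewrite orbT.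
by move/IHR=> ->; rewrite !orbT.
Qed.

Lemma fanc_uniq F i : uniq (nodes F) -> uniq (fanc F i).
Proof.
elim: F => //= v L IHL R IHR /uniq_node[vL _ /IHL uL /IHR uR _].
case: eqP => // _; case: ifP => //= _; rewrite uL andbT.
by apply: contra vL; apply: fanc_sub.
Qed.

Lemma fpar_notin F p i : i \notin nodes F -> fpar F p i = i.
Proof.
elim: F p => //= v L _ R IHR p.
by rewrite inE mem_cat !negb_or => /and3P[/negPf-> /negPf-> /IHR].
Qed.

Lemma code_root v L R : code (Node v L R) v = 0.
Proof. by rewrite /= eqxx. Qed.

Lemma code_zero v L R i : i \in nodes (Node v L R) ->
  code (Node v L R) i = 0 -> i <= v.
Proof.
rewrite inE mem_cat /=; case: eqP => [->//|_]; case: ifP => _ //= _; lia.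
Qed.

(** By induction. While [k <= size (nodes L)], [v] and the vertices of [L] with [code L] below [k]
    suffice; beyond that [v] and all of [L] count, and [R], shifted by their number, supplies the
    rest. *)
Lemma code_parking F : uniq (nodes F) -> parking (code F) (nodes F).
Proof.
elim: F => //= v L IHL R IHR u.
have [vL vR uL uR dLR] := uniq_node u.
move=> k; rewrite /= size_cat count_cat eqxx /= => ks.
have nv i : (i \in nodes L) || (i \in nodes R) -> i == v = false.
  by case: eqP => // ->; rewrite (negPf vL) (negPf vR).
have -> : count (fun i => (if i == v then 0 else if i \in nodes L then
    code L i + (v < i) else code R i + (size (nodes L)).+1) <= k) (nodes R)
    = count (fun i => code R i + (size (nodes L)).+1 <= k) (nodes R).
  by apply: eq_in_count => i iR; rewrite nv ?iR ?orbT // (negPf (dLR i iR)).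
set cL := count _ (nodes L).
(* Replacing the summand [v < i] by 1 can only lower the count. *)
have hL : count (fun i => code L i + 1 <= k) (nodes L) <= cL.
  rewrite /cL -!size_filter; apply: uniq_leq_size; first exact: filter_uniq.
  move=> i; rewrite !mem_filter => /andP[ik iL]; rewrite iL andbT nv ?iL //.
  by move: ik; case: (v < i); lia.
have [kL|Lk] := leqP k (size (nodes L)).
  case: k ks kL @cL hL => [|k] ks kL cL hL; first by lia.
  have := IHL uL k kL.
  have -> : count (fun i => code L i <= k) (nodes L) =
     count (fun i => code L i + 1 <= k.+1) (nodes L).
    by apply: eq_count => i; lia.
  by lia.
have {}hL : size (nodes L) <= cL.
  apply: leq_trans hL; rewrite eq_leq //; apply/esym/eqP; rewrite -all_count.
  by apply/allP=> i iL; have := parking_ltn (IHL uL) iL => /=; lia.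
have := IHR uR (k - (size (nodes L)).+1).
have -> : count (fun i => code R i <= k - (size (nodes L)).+1) (nodes R) =
     count (fun i => code R i + (size (nodes L)).+1 <= k) (nodes R).
  by apply: eq_count => i; lia.
by move=> /= /(_ ltac:(lia)); lia.
Qed.

(** This and its converse below trade a bound on the roots for one on the zeros of the code, both
    for [decr] and for uprootedness. *)
Lemma tops_ltn_zero F (x : nat) i : all (fun w : 'I_n => w < x) (tops F) ->
  i \in nodes F -> code F i = 0 -> i < x.
Proof.
by case: F => // v L R /andP[vx _] iF /(code_zero iF); lia.
Qed.

Lemma zero_ltn_tops F (x : nat) : decr F ->
  (forall i, i \in nodes F -> code F i = 0 -> i < x) ->
  all (fun w : 'I_n => w < x) (tops F).
Proof.
case: F => //= v L R /and3P[_ _ /allP Rv] h.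
have vx := h v (mem_head _ _) (code_root v L R).
by rewrite vx; apply/allP => w /Rv; lia.
Qed.

(* The forest below the first root consists of the vertices that burn before
   the fire returns; their number is the least [k] at which burning stalls. *)
Lemma parking_code (q : 'I_n -> nat) (s : seq 'I_n) : uniq s -> parking q s ->
  exists F, [/\ perm_eq (nodes F) s, decr F & {in s, code F =1 q}].
Proof.
have [m] := ubnP (size s); elim: m s q => // m IH s q sm us pq.
have [s0|s0] := posnP (size s).
  by exists Leaf; rewrite (size0nil s0).
have [v /andP[vs /eqP qv] vmax] : exists2 v : 'I_n, (v \in s) && (q v == 0) &
    forall i, i \in s -> q i = 0 -> i <= v.
  have/hasP[i0 i0s qi0] : has (fun i => q i <= 0) s by rewrite has_count; apply: pq.
  have P0 : (i0 \in s) && (q i0 == 0) by rewrite i0s -leqn0.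
  case: (@arg_maxnP _ i0 (fun i => (i \in s) && (q i == 0)) (@nat_of_ord n) P0).
  by move=> v Pv vm; exists v => // i si /eqP qi; apply: vm; rewrite si.
(* An [i] above [v] wastes its edge from the outer parent before [v] is tried. The subtraction is
   exact on [s] because [v] is the largest zero. *)
pose q1 i := q i - (v < i).
pose t : seq 'I_n := rem v s.
have ut : uniq t by rewrite rem_uniq.
have st : perm_eq s (v :: t) by exact: perm_to_rem.
have szs : size s = (size t).+1 by rewrite (perm_size st).
have q1E i : i \in t -> q i = q1 i + (v < i).
  rewrite mem_rem_uniq // inE => /andP[iv si]; rewrite /q1.
  case: ltnP => //; have := vmax i si; lia.
have [k kP kmin] : exists2 k, count (fun i => q1 i <= k) t <= k &
    forall j : nat, j < k -> j < count (fun i => q1 i <= j) t.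
  have ex : exists k, count (fun i => q1 i <= k) t <= k.
    by exists (size t); apply: count_size.
  case: (ex_minnP ex) => k kP kmin; exists k => // j jk.
  by rewrite ltnNge; apply/negP => /kmin; lia.
pose L : seq 'I_n := [seq i <- t | q1 i <= k].
pose R : seq 'I_n := [seq i <- t | k < q1 i].
(* For positive [k], minimality at [k.-1] gives the lower bound. *)
have szL : size L = k.
  apply/eqP; rewrite eqn_leq size_filter kP /=.
  case: k kP kmin @L @R => // k kP kmin _ _.
  by apply: leq_trans (kmin k (ltnSn k)) _; apply: sub_count => i /=; lia.
have szR : size R + k = size t.
  rewrite -szL addnC !size_filter -[RHS](count_predC (fun i => q1 i <= k)).
  by congr (_ + _); apply: eq_count => i /=; lia.
have tLR : perm_eq t (L ++ R).
  have -> : R = [seq i <- t | ~~ (q1 i <= k)] by apply: eq_filter => i; lia.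
  by rewrite perm_sym perm_filterC.
have pL : parking q1 L.
  move=> j; rewrite szL => jk; rewrite count_filter.
  apply: leq_trans (kmin j jk) _; apply: sub_count => i /=; lia.
(* A vertex of [R] has wasted its edges from [v] and from the [k] vertices of [L]. *)
pose q2 i := q i - k.+1.
have q2E i : i \in R -> q i = q2 i + k.+1.
  rewrite mem_filter => /andP[ki /q1E]; rewrite /q2; lia.
have pR : parking q2 R.
  move=> j jR.
  have := pq (j + k.+1); rewrite szs => /(_ ltac:(lia)).
  rewrite (permP st) /= qv leq0n.
  have -> : count (fun i => q i <= j + k.+1) t =
     count (fun i => q i <= j + k.+1) L + count (fun i => q i <= j + k.+1) R.
    by rewrite -count_cat (permP tLR).
  have := count_size (fun i => q i <= j + k.+1) L; rewrite szL.
  have -> : count (fun i => q2 i <= j) R = count (fun i => q i <= j + k.+1) R.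
    by apply: eq_in_count => i /q2E ->; lia.
  lia.
have [FL [nL dL cL]] := IH L q1 ltac:(lia) (filter_uniq _ ut) pL.
have [FR [nR dR cR]] := IH R q2 ltac:(lia) (filter_uniq _ ut) pR.
exists (Node v FL FR); split.
- rewrite (perm_trans _ (_ : perm_eq (v :: t) _)) ?[perm_eq _ s]perm_sym //=.
  rewrite perm_cons perm_sym (perm_trans tLR) // perm_sym.
  exact: perm_cat.
(* If [q2 i = 0] then [q i = k.+1], while [k < q1 i]; hence [q1 i = q i], and [i] is below [v]. *)
- rewrite /= dL dR /=; apply: zero_ltn_tops => // i.
  rewrite (perm_mem nR) => iR; rewrite (cR i iR) => qi0.
  have := q2E i iR; move: iR; rewrite mem_filter => /andP[ki it].
  have := q1E i it; move: it; rewrite mem_rem_uniq // inE => /andP[iv _].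
  have : (i : nat) <> v by move/val_inj/eqP; rewrite (negPf iv).
  lia.
- move=> i si /=; case: eqP => [->//|/eqP iv].
  have it : i \in t by rewrite mem_rem_uniq // inE iv.
  rewrite (perm_mem nL); case: ifPn => iL; first by rewrite cL // -q1E.
  have iR : i \in R by move: iL; rewrite !mem_filter it !andbT; lia.
  by rewrite cR // (perm_size nL) szL -q2E.
Qed.

(** On [L] the parking bound keeps the code under the threshold. On [R] the shift alone exceeds
    [size (nodes L)], and if [v < i] then [i] exceeds every root of [R], so [code R i] is positive
    as well. *)
Lemma code_below v L R i : uniq (nodes (Node v L R)) -> decr (Node v L R) ->
  i \in nodes (Node v L R) -> i != v ->
  (i \in nodes L) = (code (Node v L R) i <= size (nodes L) + (v < i)).
Proof.
move=> u d; have [vL vR uL uR dLR] := uniq_node u.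
rewrite inE mem_cat /= => iF /[dup] iv /negPf iv'; move: iF; rewrite iv' /=.
case: ifP => iL /= iR.
  by apply/esym; have := parking_ltn (code_parking uL) iL => /=; lia.
have /and3P[_ _ dR] := d.
apply/esym/negbTE; rewrite -ltnNge.
have := tops_ltn_zero dR iR.
case: (code R i) => [/(_ erefl)|m _]; lia.
Qed.

(** The first root is the largest zero of the code, the sizes of [L] and [L'] agree, and
    [code_below] then recovers their vertices. *)
Lemma code_inj F F' : uniq (nodes F) -> uniq (nodes F') -> decr F -> decr F' ->
  nodes F =i nodes F' -> {in nodes F, code F =1 code F'} -> F = F'.
Proof.
elim: F F' => [|v L IHL R IHR] [|v' L' R'] // u u' d d' eqF eqc.
- by have := eqF v'; rewrite mem_head.
- by have := eqF v; rewrite mem_head.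
have vF' : v \in nodes (Node v' L' R') by rewrite -eqF mem_head.
have v'F : v' \in nodes (Node v L R) by rewrite eqF mem_head.
have vv' : v = v'.
  apply/val_inj/eqP; rewrite eqn_leq (code_zero vF') ?(code_zero v'F) //.
    by rewrite eqc // code_root.
  by rewrite -eqc ?mem_head // code_root.
case: v' / vv' in u' d' eqF eqc vF' v'F *.
have [vL vR uL uR dLR] := uniq_node u.
have [vL' vR' uL' uR' dLR'] := uniq_node u'.
have memL i : i \in nodes L -> i \in nodes (Node v L R).
  by rewrite inE mem_cat => ->; rewrite orbT.
have memL' i : i \in nodes L' -> i \in nodes (Node v L' R').
  by rewrite inE mem_cat => ->; rewrite orbT.
have neL i : i \in nodes L -> i != v by apply: contraTneq => ->.
have szL : size (nodes L) = size (nodes L').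
  (* If [A'] were larger, parking at [k = size (nodes A)] would give more than [k] vertices of [A']
     with [code A'] at most [k], all of them in [A] by [code_below]. *)
  have aux (A B A' B' : forest n) : uniq (nodes (Node v A B)) ->
     uniq (nodes (Node v A' B')) -> decr (Node v A B) ->
     nodes (Node v A B) =i nodes (Node v A' B') ->
     {in nodes (Node v A B), code (Node v A B) =1 code (Node v A' B')} ->
     size (nodes A') <= size (nodes A).
    move=> w w' e eqN eqC; rewrite leqNgt; apply/negP => lt.
    have [_ _ wA _ _] := uniq_node w.
    have [vA' _ wA' _ _] := uniq_node w'.
    have := code_parking wA' lt; apply/negP; rewrite -leqNgt -size_filter.
    apply: uniq_leq_size; first exact: filter_uniq.
    move=> i; rewrite mem_filter => /andP[ci iA'].
    have iv : i != v by apply: contraTneq iA' => ->.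
    have iF : i \in nodes (Node v A B) by rewrite eqN inE mem_cat iA' orbT.
    rewrite (code_below w e iF iv) (eqC i iF) /= (negPf iv) iA'.
    by rewrite leq_add2r.
  apply/eqP; rewrite eqn_leq (aux _ _ _ _ u' u) ?(aux _ _ _ _ u u') //.
  by move=> i; rewrite -eqF => /eqc.
have eqL : nodes L =i nodes L'.
  move=> i; have [iv|iv] := eqVneq i v; first by rewrite iv (negPf vL) (negPf vL').
  have [iF|iF] := boolP (i \in nodes (Node v L R)).
    by rewrite (code_below u d) // (code_below u' d') -?eqF // eqc // szL.
  by rewrite (contraNF (@memL i)) // (contraNF (@memL' i)) // -eqF.
have eqR : nodes R =i nodes R'.
  move=> i; have := eqF i; rewrite !inE !mem_cat eqL.
  have [iL|iL] := boolP (i \in nodes L').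
    by rewrite (contraTF (@dLR i)) ?eqL ?iL // (contraTF (@dLR' i)) ?iL.
  case: eqP => //= -> _; by rewrite (negPf vR) (negPf vR').
have /and3P[dL dR _] := d.
have /and3P[dL' dR' _] := d'.
congr Node; [apply: IHL | apply: IHR] => // i iX.
- by have := eqc i (memL i iX); rewrite /= (negPf (neL i iX)) -eqL iX => /addIn.
- have iF : i \in nodes (Node v L R) by rewrite inE mem_cat iX !orbT.
  have iv : i != v by apply: contraTneq iX => ->.
  by have := eqc i iF; rewrite /= (negPf iv) -eqL (negPf (dLR i iX)) szL => /addIn.
Qed.

(** Together with the outer parent, [m] vertices span ['C(m.+1, 2)] edges; [m] burn, so ['C(m, 2)]
    are wasted or untried. In the induction, [v < i] and [i < v] share out the pairs of [v] with
    [L], and the shift counts the pairs from [v] and [L] into [R]. *)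
Lemma sum_code F : uniq (nodes F) ->
  \sum_(i <- nodes F) code F i + forest_inv F = 'C(size (nodes F), 2).
Proof.
elim: F => [|v L IHL R IHR] u; first by rewrite /forest_inv !big_nil.
have [vL vR uL uR dLR] := uniq_node u.
have nv i : (i \in nodes L) || (i \in nodes R) -> i == v = false.
  by case: eqP => // ->; rewrite (negPf vL) (negPf vR).
rewrite /forest_inv /= !big_cons !big_cat /= eqxx /= add0n.
have -> : \sum_(i <- nodes L) (if i == v then 0 else if i \in nodes L then
    code L i + (v < i) else code R i + (size (nodes L)).+1) =
    \sum_(i <- nodes L) code L i + \sum_(i <- nodes L) (v < i).
  rewrite -big_split; apply: eq_big_seq => i iL /=; by rewrite nv iL.
have -> : \sum_(i <- nodes R) (if i == v then 0 else if i \in nodes L then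
    code L i + (v < i) else code R i + (size (nodes L)).+1) =
    \sum_(i <- nodes R) code R i + (size (nodes L)).+1 * size (nodes R).
  rewrite -[in RHS]iter_addn_0 -[in RHS](count_predT (nodes R)) -big_const_seq.
  rewrite -big_split; apply: eq_big_seq => i iR /=.
  by rewrite nv ?iR ?orbT // (negPf (dLR i iR)).
have -> : \sum_(i <- nodes L) count (fun j : 'I_n => i < j) (if i == v then [::]
    else if i \in nodes L then v :: fanc L i else fanc R i) =
    \sum_(i <- nodes L) (i < v) + forest_inv L.
  rewrite -big_split; apply: eq_big_seq => i iL /=; by rewrite nv iL.
have -> : \sum_(i <- nodes R) count (fun j : 'I_n => i < j) (if i == v then [::]
    else if i \in nodes L then v :: fanc L i else fanc R i) = forest_inv R.
  apply: eq_big_seq => i iR /=.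
  by rewrite nv ?iR ?orbT // (negPf (dLR i iR)).
have : \sum_(i <- nodes L) (v < i) + \sum_(i <- nodes L) (i < v) = size (nodes L).
  rewrite -big_split -sum1_size; apply: eq_big_seq => i iL /=.
  have /eqP : i != v by rewrite nv ?iL.
  by case: ltngtP => // /val_inj ->.
rewrite size_cat binS bin1 bin2D; move: (IHL uL) (IHR uR); lia.
Qed.
End Forests.

(** * Forests and parent functions *)

Section ParentFunctions.
Variable n : nat.
Implicit Types (F L R : forest n) (i j v p : 'I_n) (f : 'I_n -> 'I_n).

Lemma fpar_node f v L R p : uniq (nodes (Node v L R)) ->
  {in nodes (Node v L R), f =1 fpar (Node v L R) p} ->
  [/\ f v = p, {in nodes L, f =1 fpar L v} & {in nodes R, f =1 fpar R p}].
Proof.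
move=> u fF; have [vL vR uL uR dLR] := uniq_node u.
split; first by rewrite fF ?mem_head //= eqxx.
  move=> i iL; rewrite fF ?inE ?mem_cat ?iL ?orbT //=.
  by case: eqP iL => [->|_ ->]; rewrite ?(negPf vL).
move=> i iR; rewrite fF ?inE ?mem_cat ?iR ?orbT //= (negPf (dLR i iR)).
by case: eqP iR => [->|//]; rewrite (negPf vR).
Qed.

Lemma fpar_mem F p i : i \in nodes F -> fpar F p i \in p :: nodes F.
Proof.
elim: F p => //= v L IHL R IHR p; rewrite inE mem_cat.
case: eqP => [_ _|_ /=]; first exact: mem_head.
case: ifP => [iL _|_ /= iR].
  by have := IHL v iL; rewrite !inE mem_cat; case/orP=> ->; rewrite ?orbT.
by have := IHR p iR; rewrite !inE mem_cat; case/orP=> ->; rewrite ?orbT.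
Qed.

Lemma fpar_tops F p i : uniq (nodes F) -> p \notin nodes F ->
  i \in nodes F -> (fpar F p i == p) = (i \in tops F).
Proof.
elim: F => //= v L IHL R IHR u; have [vL vR uL uR dLR] := uniq_node u.
rewrite !inE !mem_cat !negb_or => /and3P[pv pL pR].
case: (eqVneq i v) => [_ _|_ /=]; first by rewrite eqxx.
case: ifP => [iL _|iL /= iR]; last exact: IHR.
have -> : i \in tops R = false by apply/negP=> /tops_sub/dLR; rewrite iL.
have := fpar_mem v iL; rewrite inE; case: eqP => [->|_ /= fL].
  by rewrite eq_sym (negPf pv).
by apply/eqP=> fp; move: fL; rewrite fp (negPf pL).
Qed.

(** Following [f] from [i] runs through its ancestors and reaches [p], after which the second
    disjunct takes over. *)
Lemma fconnect_forest f F p i j : uniq (nodes F) ->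
  {in nodes F, f =1 fpar F p} -> i \in nodes F ->
  fconnect f i j = (j \in i :: fanc F i) || fconnect f p j.
Proof.
elim: F p => // v L IHL R IHR p u fF.
have [fv fL fR] := fpar_node u fF; have [vL vR uL uR dLR] := uniq_node u.
rewrite inE mem_cat /=.
case: (eqVneq i v) => [-> _|_ /=].
  by rewrite fconnect_eqVf fv inE eq_sym.
case: ifP => [iL _|_ /= iR]; last exact: IHR.
rewrite (IHL v) // [fconnect f v j]fconnect_eqVf fv !inE (eq_sym v).
by case: (j == i); case: (j == v); case: (j \in fanc L i).
Qed.

Lemma fconnect_below f v L R p i : uniq (nodes (Node v L R)) ->
  {in nodes (Node v L R), f =1 fpar (Node v L R) p} ->
  ~~ fconnect f p v -> i \in nodes (Node v L R) -> i != v ->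
  (i \in nodes L) = fconnect f i v.
Proof.
move=> u fF pv iF iv; rewrite (fconnect_forest _ u fF iF) (negPf pv) orbF.
have [vL vR uL uR dLR] := uniq_node u.
move: iF; rewrite !inE (eq_sym v i) mem_cat /= (negPf iv) /=.
case: ifP => iL /=; first by rewrite mem_head.
by move=> iR; apply/esym/negbTE; apply: contra vR => /fanc_sub.
Qed.

(** The first root is the largest vertex sent to [p], and [L] consists of the other vertices leading
    to it, so [f] determines both parts. The last hypothesis keeps paths from coming back through
    [p]. *)
Lemma fpar_inj f F F' p : uniq (nodes F) -> uniq (nodes F') ->
  decr F -> decr F' -> nodes F =i nodes F' ->
  {in nodes F, f =1 fpar F p} -> {in nodes F', f =1 fpar F' p} ->
  (forall i, i \in nodes F -> ~~ fconnect f p i) -> F = F'.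
Proof.
elim: F F' p => [|v L IHL R IHR] [|v' L' R'] p // u u' d d' eqF fF fF' npF.
- by have := eqF v'; rewrite mem_head.
- by have := eqF v; rewrite mem_head.
have pF : p \notin nodes (Node v L R) by apply/negP=> /npF; rewrite connect0.
have pF' : p \notin nodes (Node v' L' R') by rewrite -eqF.
have vF' : v \in nodes (Node v' L' R') by rewrite -eqF mem_head.
have v'F : v' \in nodes (Node v L R) by rewrite eqF mem_head.
have [fv fL fR] := fpar_node u fF; have [fv' fL' fR'] := fpar_node u' fF'.
have max w (A B : forest n) i : decr (Node w A B) -> i \in tops (Node w A B) -> i <= w.
  by case/and3P=> _ _ /allP h; rewrite inE => /orP[/eqP->//|/h /ltnW].
have vv' : v = v'.
  apply/val_inj/eqP; rewrite eqn_leq.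
  rewrite (max _ _ _ _ d') ?(max _ _ _ _ d) //.
    by rewrite -(fpar_tops u pF) // -fF // fv'.
  by rewrite -(fpar_tops u' pF') // -fF' // fv.
case: v' / vv' in u' d' eqF fF' pF' vF' v'F fv' fL' fR' *.
have [vL vR uL uR dLR] := uniq_node u.
have [vL' vR' uL' uR' dLR'] := uniq_node u'.
have npv := npF v (mem_head _ _).
have subL (A B : forest n) i : i \in nodes A -> i \in nodes (Node v A B).
  by rewrite inE mem_cat => ->; rewrite orbT.
have eqL : nodes L =i nodes L'.
  move=> i; have [iv|iv] := eqVneq i v; first by rewrite iv (negPf vL) (negPf vL').
  have [iF|iF] := boolP (i \in nodes (Node v L R)).
    by rewrite (fconnect_below u fF) // (fconnect_below u' fF') -?eqF.
  by rewrite (contraNF (@subL L R i)) // (contraNF (@subL L' R' i)) // -eqF.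
have eqR : nodes R =i nodes R'.
  move=> i; have := eqF i; rewrite !inE !mem_cat eqL.
  have [iL|iL] := boolP (i \in nodes L').
    by rewrite (contraTF (@dLR i)) ?eqL ?iL // (contraTF (@dLR' i)) ?iL.
  case: eqP => //= -> _; by rewrite (negPf vR) (negPf vR').
have /and3P[dL dR _] := d.
have /and3P[dL' dR' _] := d'.
congr Node; [apply: (IHL _ v) | apply: (IHR _ p)] => // i iX.
- rewrite fconnect_eqVf fv negb_or npF ?subL // andbT.
  by apply: contraTneq iX => <-.
- by rewrite npF // inE mem_cat iX !orbT.
Qed.

(** The largest child of [p] becomes the first root, its proper descendants form [L] and the rest
    [R]. The hypotheses say that paths from [s] stay in [s] until they reach [p], and never
    return. *)
Lemma par_forest f p (s : seq 'I_n) : uniq s ->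
  (forall i, i \in s -> fconnect f i p) ->
  (forall i, i \in s -> f i \in p :: s) ->
  (forall i, i \in s -> ~~ fconnect f p i) ->
  exists F, [/\ perm_eq (nodes F) s, decr F & {in s, f =1 fpar F p}].
Proof.
have [m] := ubnP (size s); elim: m s p => // m IH s p sm us cs fs ns.
have [s0|s0] := posnP (size s).
  by exists Leaf; rewrite (size0nil s0).
have ps : p \notin s by apply/negP=> /ns; rewrite connect0.
have [v /andP[vs /eqP fv] vmax] : exists2 v : 'I_n, (v \in s) && (f v == p) &
    forall i, i \in s -> f i = p -> i <= v.
  have [i0 P0] : exists i, (i \in s) && (f i == p).
    have [i si] : exists i, i \in s.
      by case: s s0 {sm us cs fs ns ps} => // i s; exists i; rewrite mem_head.
    (* On the path from [i] to [p] the last vertex before [p] is a child of [p]; induction on the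
       length of the path. *)
    move: (findex f i p) (iter_findex (cs i si)) => k.
    elim: k i si => [|k IHk] i si.
      by move=> ip; move: ps; rewrite -ip /= si.
    rewrite iterSr; have := fs i si; rewrite inE => /orP[fp _|]; last exact: IHk.
    by exists i; rewrite si.
  case: (@arg_maxnP _ i0 (fun i => (i \in s) && (f i == p)) (@nat_of_ord n) P0).
  by move=> v Pv vm; exists v => // i si /eqP fi; apply: vm; rewrite si.
pose t : seq 'I_n := rem v s.
have ut : uniq t by rewrite rem_uniq.
have tE i : (i \in t) = (i != v) && (i \in s) by rewrite mem_rem_uniq.
have st : perm_eq s (v :: t) by exact: perm_to_rem.
have szs : size s = (size t).+1 by rewrite (perm_size st).
pose L : seq 'I_n := [seq i <- t | fconnect f i v].
pose R : seq 'I_n := [seq i <- t | ~~ fconnect f i v].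
have tLR : perm_eq t (L ++ R) by rewrite perm_sym perm_filterC.
have szt : size t = size L + size R by rewrite (perm_size tLR) size_cat.
have npv := ns v vs.
have [|i|i|i|FL [nL dL fL]] := IH L v _ (filter_uniq _ ut).
- lia.
- by rewrite mem_filter => /andP[].
- rewrite mem_filter tE => /and3P[civ iv si].
  have := civ; rewrite fconnect_eqVf (negPf iv) /= => cfv.
  rewrite inE mem_filter tE cfv /=; case: eqVneq => //= _.
  have := fs i si; rewrite inE => /orP[/eqP fp|//].
  by move: cfv; rewrite fp (negPf npv).
- rewrite mem_filter tE => /and3P[civ iv si].
  by rewrite fconnect_eqVf fv negb_or ns // eq_sym iv.
have [|i|i|i|FR [nR dR fR]] := IH R p _ (filter_uniq _ ut).
- lia.
- by rewrite mem_filter tE => /and3P[_ _ /cs].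
- rewrite mem_filter tE => /and3P[civ iv si].
  have := civ; rewrite fconnect_eqVf negb_or iv /= => cfv.
  have := fs i si; rewrite !inE mem_filter tE => /orP[->//|->].
  by move: cfv; case: (eqVneq (f i) v) => [->|_ ->]; rewrite ?connect0 ?orbT.
- by rewrite mem_filter tE => /and3P[_ _ /ns].
exists (Node v FL FR); split.
- rewrite (perm_trans _ (_ : perm_eq (v :: t) _)) ?[perm_eq _ s]perm_sym //=.
  rewrite perm_cons perm_sym (perm_trans tLR) // perm_sym.
  exact: perm_cat.
- rewrite /= dL dR /=; apply/allP => i iR0.
  have iR : i \in R by rewrite -(perm_mem nR) tops_sub.
  have uR : uniq (nodes FR) by rewrite (perm_uniq nR) filter_uniq.
  have pR : p \notin nodes FR.
    by rewrite (perm_mem nR) mem_filter tE !negb_and ps !orbT.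
  have : f i = p.
    by apply/eqP; rewrite fR // fpar_tops // tops_sub.
  move: iR; rewrite mem_filter tE => /and3P[_ iv si] /(vmax i si).
  by rewrite leq_eqVlt => /orP[/eqP/val_inj ie|//]; rewrite ie eqxx in iv.
- move=> i si /=; case: eqP => [->//|/eqP iv].
  have it : i \in t by rewrite tE iv.
  rewrite (perm_mem nL); case: ifPn => iL; first by rewrite fL.
  by rewrite fR //; move: iL; rewrite !mem_filter it !andbT.
Qed.

End ParentFunctions.

(** * Rooted trees as a root with a forest below it *)

Section RootedTrees.
Variable n : nat.
Implicit Types (T : rtree n) (F : forest n).

Definition spans (r : 'I_n) F : Prop := perm_eq (r :: nodes F) (enum 'I_n).

Lemma spans_uniq r F : spans r F -> uniq (nodes F).
Proof. by move/perm_uniq; rewrite enum_uniq => /andP[]. Qed.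

Lemma spans_notin r F : spans r F -> r \notin nodes F.
Proof. by move/perm_uniq; rewrite enum_uniq => /andP[]. Qed.

Lemma spans_mem r F i : spans r F -> (i \in nodes F) = (i != r).
Proof.
move=> rF; have := perm_mem rF i; rewrite mem_enum inE.
by case: eqVneq => //= ->; rewrite (negPf (spans_notin rF)).
Qed.

Lemma spans_size r F : spans r F -> (size (nodes F)).+1 = n.
Proof. by move/perm_size => /=; rewrite size_enum_ord. Qed.

Lemma rtree_eq T T' : root T = root T' -> par T =1 par T' -> T = T'.
Proof.
case: T T' => [r f fr fc] [r' f' fr' fc'] /= rr' /ffunP ff'.
case: r' / rr' in fr' fc' *; case: f' / ff' in fr' fc' *.
by rewrite (bool_irrelevance fr fr') (bool_irrelevance fc fc').
Qed.

Lemma par_rootE T : par T (root T) = root T.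
Proof. exact/eqP/par_root. Qed.

Lemma fconnect_root T i : fconnect (par T) (root T) i = (i == root T).
Proof.
apply/idP/eqP=> [/iter_findex <-|->]; last exact: connect0.
by elim: (findex (par T) (root T) i) => //= k ->; apply: par_rootE.
Qed.

(** If [i] and [j] differ, [i] lies on a cycle, so every iterate leads back to [i], the root
    included. But the root is fixed, which forces [i], and then [j], to be the root. *)
Lemma fconnect_par_anti T i j :
  fconnect (par T) i j -> fconnect (par T) j i -> i = j.
Proof.
move=> ij ji; have [//|ne] := eqVneq i j.
have cyc : fconnect (par T) (par T i) i.
  by move: ij; rewrite fconnect_eqVf (negPf ne) => /connect_trans; apply.
have stays m : fconnect (par T) (iter m (par T) i) i.
  elim: m => [|m IH]; first exact: connect0.
  have := IH; rewrite fconnect_eqVf => /orP[/eqP e|]; last by rewrite iterS.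
  by rewrite iterS e.
have /forallP/(_ i)/iter_findex ri := par_connect T.
have := stays (findex (par T) i (root T)); rewrite ri fconnect_root => /eqP ir.
by move: ij; rewrite ir fconnect_root => /eqP ->.
Qed.

Lemma forest_rtree r F : spans r F ->
  exists2 T, root T = r & par T =1 fpar F r.
Proof.
move=> rF; pose f := [ffun i => fpar F r i].
have fr : f r == r by rewrite ffunE fpar_notin ?spans_notin.
have fc : [forall i, fconnect f i r].
  apply/forallP=> i; have [->|ir] := eqVneq i r; first exact: connect0.
  have fF : {in nodes F, f =1 fpar F r} by move=> k _; rewrite ffunE.
  rewrite (fconnect_forest _ (spans_uniq rF) fF) ?connect0 ?orbT //.
  by rewrite (spans_mem _ rF).
by exists (RTree fr fc) => // i; rewrite /= ffunE.
Qed.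

Lemma rtree_forest T :
  exists F, [/\ spans (root T) F, decr F & par T =1 fpar F (root T)].
Proof.
pose s := rem (root T) (enum 'I_n).
have us : uniq s by rewrite rem_uniq ?enum_uniq.
have sE i : (i \in s) = (i != root T).
  by rewrite mem_rem_uniq ?enum_uniq // inE mem_enum andbT.
have [i _|i|i|F [nF dF fF]] := par_forest (f := par T) (p := root T) us.
- by have /forallP := par_connect T.
- by rewrite !inE sE; case: eqP.
- by rewrite sE fconnect_root.
have rF : spans (root T) F.
  rewrite /spans (perm_trans (_ : perm_eq _ (root T :: s))) ?perm_cons //.
  by rewrite perm_sym perm_to_rem ?mem_enum.
exists F; split=> // i; have [->|ir] := eqVneq i (root T).
  by rewrite par_rootE fpar_notin ?spans_notin.
by rewrite fF ?sE.
Qed.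

Lemma rtree_forest_uniq T F F' : spans (root T) F -> spans (root T) F' ->
  decr F -> decr F' -> par T =1 fpar F (root T) -> par T =1 fpar F' (root T) ->
  F = F'.
Proof.
move=> rF rF' dF dF' fF fF'.
apply: (fpar_inj (f := par T) (p := root T)) => //.
- exact: spans_uniq rF.
- exact: spans_uniq rF'.
- by move=> i; rewrite (spans_mem _ rF) (spans_mem _ rF').
- by move=> i; rewrite fconnect_root (spans_mem _ rF).
Qed.

Lemma uprooted_forest T F : spans (root T) F -> par T =1 fpar F (root T) ->
  uprooted T = all (fun w : 'I_n => w < root T) (tops F).
Proof.
move=> rF fF; rewrite /uprooted /is_child.
have key i : (i != root T) && (par T i == root T) = (i \in tops F).
  rewrite fF -(spans_mem _ rF); apply/andP/idP => [[iF]|iF].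
    by rewrite (fpar_tops (spans_uniq rF) (spans_notin rF)).
  have {}iF' := tops_sub iF.
  by rewrite (fpar_tops (spans_uniq rF) (spans_notin rF)).
apply/forallP/allP => h i; first by move=> iF; have := h i; rewrite key iF.
by apply/implyP; rewrite key => /h.
Qed.

(** Each inversion weighs exactly [b]: the parent of [i] cannot be its descendant [j]. *)
Lemma kappa_forest (a b : nat) T F :
  spans (root T) F -> par T =1 fpar F (root T) ->
  kappa (del_root (complete_multigraph n a b)) T = b * forest_inv F.
Proof.
move=> rF fF; rewrite /kappa.
rewrite (exchange_big_dep (fun j => j != root T)) /=; last by move=> i j _ /and3P[].
rewrite /forest_inv big_distrr /=.
transitivity (\sum_(j <- nodes F) \sum_(i | (i \in fanc F j) && (j < i)) b).
  have -> : \sum_(j <- nodes F) \sum_(i | (i \in fanc F j) && (j < i)) b =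
      \sum_(j in nodes F) \sum_(i | (i \in fanc F j) && (j < i)) b.
    by rewrite big_uniq ?(spans_uniq rF).
  apply: eq_big => [j|j jr]; first by rewrite (spans_mem _ rF).
  have jF : j \in nodes F by rewrite (spans_mem _ rF).
  apply: eq_big => [i|i].
    rewrite jr /= /ancestor.
    rewrite (fconnect_forest _ (spans_uniq rF) (in1W fF) jF).
    rewrite fconnect_root inE; have := @fanc_sub _ F j i; rewrite (spans_mem _ rF).
    case: (eqVneq i j) => [->|_]; first by rewrite ltnn !andbF.
    by case: (i \in fanc F j) => /= [->//|_]; case: eqP.
  case/and3P=> ir _ /andP[/andP[_ ij] ltij].
  rewrite /complete_mult /vtx (inj_eq lift_inj) /=.
  case: eqP => // pij; have := fconnect1 (par T) i.
  rewrite pij => /fconnect_par_anti/(_ ij) e.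
  by rewrite e ltnn in ltij.
apply: eq_big_seq => j jF.
rewrite big_const iter_addn_0 -size_filter; congr (_ * _).
rewrite -(card_uniqP _); last by rewrite filter_uniq // fanc_uniq // (spans_uniq rF).
by apply: eq_card => i; rewrite mem_filter unfold_in andbC.
Qed.

End RootedTrees.

(** * Spherical parking functions of complete multigraphs *)

Import GRing.Theory.

Lemma mcoeffMX_eq0 (R : nzRingType) (n : nat) (p : {mpoly R[n]})
    (m k : 'X_{1..n}) : ~~ (m <= k)%MM -> ((p * 'X_[m])@_k = 0)%R.
Proof.
move=> mk; apply: memN_msupp_eq0; rewrite (perm_mem (msuppMX p m)).
by apply/mapP=> -[m' _ kE]; rewrite kE lem_addr in mk.
Qed.

(** Compare coefficients at [P]: a multiple of a monomial that does not divide ['X_[P]] has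
    coefficient 0 there. *)
Lemma in_ideal_monomial (R : comNzRingType) (n : nat) (I : finType) (D : {pred I})
    (m : I -> 'X_{1..n}) (P : 'X_{1..n}) :
  in_ideal D (fun i => 'X_[R, m i] : {mpoly R[n]}) 'X_[R, P] <->
  exists2 i, i \in D & (m i <= P)%MM.
Proof.
split=> [[c PE]|[i iD mP]]; last first.
  exists (fun j => if j == i then 'X_[(P - m i)] else 0)%R.
  rewrite (bigD1 i) //= eqxx -mpolyXD submK // big1 ?addr0 // => j /andP[_].
  by move/negPf->; rewrite mul0r.
apply/exists_inP; apply: contraT; rewrite negb_exists_in => /forall_inP nle.
have := congr1 (mcoeff P) PE; rewrite mcoeffX eqxx raddf_sum big1 => [/eqP|i iD].
  by rewrite oner_eq0.
by rewrite /= mcoeffMX_eq0 ?nle.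
Qed.

Lemma mono_monomial (K : fieldType) (n : nat) (G : multigraph n.+1)
    (A : {set 'I_n}) :
  mono K G A = ('X_[[multinom (if i \in A then outdeg G A i else 0) | i < n]])%R.
Proof.
rewrite mpolyXE_id /mono big_mkcond /=; apply: eq_bigr => i _.
by rewrite mnmE; case: ifP => // _; rewrite expr0.
Qed.

Lemma in_ideal_mono (K : fieldType) (n : nat) (G : multigraph n.+1)
    (D : {pred {set 'I_n}}) (P : 'X_{1..n}) :
  in_ideal D (mono K G) 'X_[K, P] <->
  exists2 A, A \in D & forall i, i \in A -> outdeg G A i <= P i.
Proof.
pose m (A : {set 'I_n}) := [multinom (if i \in A then outdeg G A i else 0) | i < n].
have -> : in_ideal D (mono K G) 'X_[K, P] <->
    in_ideal D (fun A => 'X_[K, m A] : {mpoly K[n]}) 'X_[K, P].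
  split=> -[c ->]; exists c; apply: eq_bigr => A _; by rewrite mono_monomial.
rewrite in_ideal_monomial; split=> -[A AD mA]; exists A => //.
  by move=> i iA; have := mnm_lepP mA i; rewrite mnmE iA.
by apply/mnm_lepP => i; rewrite mnmE; case: ifP => // /mA.
Qed.

Lemma outdeg_complete (n a b : nat) (A : {set 'I_n}) (i : 'I_n) : i \in A ->
  outdeg (complete_multigraph n a b) A i = a + b * (n - #|A|).
Proof.
move=> iA; rewrite /outdeg big_mkcond big_ord_recl /=; congr (_ + _).
  rewrite inE ifT //; apply/imsetP => -[j _ /(congr1 val)] //.
transitivity (\sum_(j in ~: A) b).
  rewrite [RHS]big_mkcond; apply: eq_bigr => j _ /=.
  rewrite -/(vtx j) !inE mem_imset; last exact: lift_inj.
  rewrite /complete_mult (inj_eq lift_inj).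
  by case: ifP => //; case: eqP => // <-; rewrite iA.
by rewrite sum_nat_const mulnC cardsCs setCK card_ord.
Qed.

(** Deleting a zero lowers each count by one and leaves an ordinary parking function on [n.-1]
    vertices. *)
Definition prime_parking (n : nat) (q : 'I_n -> nat) : Prop :=
  forall k, k < n.-1 -> k.+1 < count (fun i => q i <= k) (enum 'I_n).

(** The generator of [A] divides ['X_[P]] when [a + b * (n - #|A|) <= P i] on [A]. Only the full set
    may do so: this is [a <= P i] everywhere, while the failure of all smaller sets is primality of
    the quotients. *)
Lemma sPF_complete (K : fieldType) (n a b : nat) (P : 'X_{1..n}) :
  1 < n -> 0 < b ->
  sPF K (complete_multigraph n a b) P <->
  (forall i, a <= P i) /\ prime_parking (fun i : 'I_n => (P i - a) %/ b).
Proof.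
move=> n1 b0; rewrite /sPF /in_M /in_Mk !in_ideal_mono.
have cnt k : count (fun i => (P i - a) %/ b <= k) (enum 'I_n) =
    #|[set i | (P i - a) %/ b <= k]|.
  by rewrite -sum1_count big_enum_cond -sum1_card; apply: eq_bigl => i; rewrite !inE.
split=> [[[A A0 AP] notk]|[aP pP]].
- have dn : (n - 2).+1 = n.-1 by lia.
  have small (B : {set 'I_n}) : B != set0 -> #|B| <= n.-1 ->
      exists2 i, i \in B & P i < a + b * (n - #|B|).
    move=> B0 Bn; apply/exists_inP; apply: contraT.
    rewrite negb_exists_in => /forall_inP h; case: notk; exists B.
      by rewrite inE B0 dn.
    by move=> i iB; rewrite outdeg_complete // leqNgt h.
  have cA : #|A| = n.
    have := max_card A; rewrite card_ord leq_eqVlt => /orP[/eqP//|An].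
    have [||i iA] := small A; [by [] | lia |].
    by rewrite ltnNge -(outdeg_complete a b iA) AP.
  have AT : A = setT by apply/eqP; rewrite eqEcard subsetT cardsT card_ord cA leqnn.
  split=> [i|k kn].
    have iA : i \in A by rewrite AT inE.
    by have := AP i iA; rewrite outdeg_complete // cA subnn muln0 addn0.
  rewrite cnt; set S := [set _ | _]; rewrite ltnNge; apply/negP => Sk.
  (* On [B] the quotients exceed [k]; with [n - #|B| <= k.+1] its generator divides ['X_[P]],
     against [small]. *)
  have aux (B : {set 'I_n}) c : #|B| = c -> B \subset ~: S -> 0 < c ->
      c <= n.-1 -> n - c <= k.+1 -> False.
    move=> <- /subsetP BS B0 Bn nB.
    have [|//|i iB iP] := small B; first by rewrite -card_gt0.
    have := BS i iB; rewrite !inE -ltnNge leq_divRL // => kP.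
    have := leq_mul2l b (n - #|B|) k.+1; rewrite nB orbT; lia.
  have [c cE] : exists c, #|~: S| = c by exists #|~: S|.
  have [d dE] : exists d, #|S| = d by exists #|S|.
  have cS : d + c = n by rewrite -dE -cE cardsC card_ord.
  rewrite dE in Sk.
  have [Cn|Cn] := leqP c n.-1.
    by apply: (aux (~: S) c); rewrite ?subxx //; lia.
  (* Here the complement of [S] is the whole vertex set, too large for [small]; one vertex is
     dropped. *)
  have S0 : d = 0 by lia.
  pose i0 : 'I_n := Ordinal (ltnW n1).
  apply: (aux (~: S :\ i0) n.-1); rewrite ?subD1set //; try lia.
  have := cardsD1 i0 (~: S); rewrite cE inE.
  have -> : i0 \notin S by rewrite (cards0_eq (etrans dE S0)) inE.
  by move: #|_ :\ _| => e; lia.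
- split.
    exists [set: 'I_n].
      by rewrite inE -card_gt0 cardsT card_ord; lia.
    by move=> i _; rewrite outdeg_complete ?inE // cardsT card_ord subnn muln0 addn0.
  case=> A; rewrite inE => /andP[A0 An] AP.
  have An' : #|A| <= n.-1 by lia.
  move: A0; rewrite -card_gt0 => A0.
  (* At this index [S] has more than [n - #|A|] vertices and so meets [A]. *)
  have := pP (n - #|A|).-1; rewrite cnt => /(_ ltac:(lia)).
  set S := [set _ | _] => cS.
  have : 0 < #|A :&: S|.
    have := cardsUI A S; have := max_card (A :|: S); rewrite card_ord.
    move: A0 An' cS {An}.
    by move: #|A| #|S| #|A :|: S| #|A :&: S| => x y z t; lia.
  rewrite card_gt0 => /set0Pn[i]; rewrite !inE => /andP[iA].
  have := AP i iA; rewrite outdeg_complete // leqNgt => /negP h.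
  move=> qi; apply: h; have := aP i; move: qi.
  rewrite -ltnS prednK; last by lia.
  rewrite ltn_divLR // mulnC; lia.
Qed.

Lemma prime_parking_forest (n : nat) (q : 'I_n -> nat) : 1 < n ->
  prime_parking q ->
  exists r F, [/\ spans r F, decr F, all (fun w : 'I_n => w < r) (tops F)
    & forall i, q i = if i == r then 0 else code F i].
Proof.
move=> n1 pq.
have [r /eqP qr rmax] : exists2 r : 'I_n, q r == 0 & forall i, q i = 0 -> i <= r.
  have/hasP[i0 _ qi0] : has (fun i => q i <= 0) (enum 'I_n).
    by rewrite has_count; apply: ltnW (pq 0 _); lia.
  rewrite leqn0 in qi0.
  case: (@arg_maxnP _ i0 (fun i => q i == 0) (@nat_of_ord n) qi0) => r qr rm.
  by exists r => // i /eqP/rm.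
pose s : seq 'I_n := rem r (enum 'I_n).
have us : uniq s by rewrite rem_uniq ?enum_uniq.
have sE i : (i \in s) = (i != r).
  by rewrite mem_rem_uniq ?enum_uniq // inE mem_enum andbT.
have es : perm_eq (enum 'I_n) (r :: s) by rewrite perm_to_rem ?mem_enum.
have szs : (size s).+1 = n by rewrite -[RHS]size_enum_ord (perm_size es).
have ps : parking q s.
  move=> k ks; have := pq k ltac:(lia).
  by rewrite (permP es) /= qr.
have [F [nF dF cF]] := parking_code us ps.
exists r, F; split=> //.
- by rewrite /spans [perm_eq _ (enum _)]perm_sym (perm_trans es) // perm_cons perm_sym.
- apply: zero_ltn_tops => // i; rewrite (perm_mem nF) => si; rewrite cF // => /rmax.
  rewrite leq_eqVlt => /orP[/eqP/val_inj ir|//].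
  by rewrite sE ir eqxx in si.
- by move=> i; case: eqP => [->//|/eqP ir]; rewrite cF // sE.
Qed.

Lemma forest_prime_parking (n : nat) (r : 'I_n) (F : forest n) : spans r F ->
  prime_parking (fun i => if i == r then 0 else code F i).
Proof.
move=> rF k kn; rewrite -(permP rF) /= eqxx /= add1n ltnS.
have kF : k < size (nodes F) by have := spans_size rF; lia.
have := code_parking (spans_uniq rF) kF.
congr (_ < _); apply: eq_in_count => i; rewrite (spans_mem _ rF) => /negPf -> //.
Qed.

Lemma nedges_complete (n a b : nat) :
  nedges (complete_multigraph n a b) = a * n + b * 'C(n, 2).
Proof.
rewrite /nedges big_ord_recl /=; congr (_ + _).
  rewrite big_mkcond big_ord_recl /= add0n.
  rewrite (eq_bigr (fun=> a)) ?sum_nat_const ?card_ord 1?mulnC // => i _.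
transitivity (\sum_(i < n) \sum_(j < n | i < j) b).
  apply: eq_bigr => i _; rewrite big_mkcond big_ord_recl /= add0n [RHS]big_mkcond.
  apply: eq_bigr => j _; rewrite /bump /= !add1n ltnS; case: ltnP => // ij.
  rewrite /complete_mult (inj_eq lift_inj) ifF //.
  by apply/eqP => e; rewrite e ltnn in ij.
rewrite (exchange_big_dep xpredT) //= -bin2_sum big_mkord big_distrr /=.
apply: eq_bigr => j _; rewrite -(big_ord_widen _ (fun=> b)) ?(ltnW (ltn_ord j)) //.
by rewrite sum_nat_const card_ord mulnC.
Qed.

(** * Edge labels and the bijection *)

Section EdgeLabels.
Variables (n : nat) (T : rtree n).

(** Distinct vertices with the same upward edge would be parents of each other. Edges can thus be
    indexed by their lower endpoints. *)
Lemma edge_inj : {in [set~ root T] &, injective (fun i => [set par T i; i])}.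
Proof.
move=> i j; rewrite !inE => ir jr eij; have [//|ne] := eqVneq i j.
have : i \in [set par T j; j] by rewrite -eij !inE eqxx orbT.
rewrite !inE (negPf ne) orbF => /eqP ij.
have : j \in [set par T i; i] by rewrite eij !inE eqxx orbT.
rewrite !inE (eq_sym j i) (negPf ne) orbF => /eqP ji.
by apply: (@fconnect_par_anti _ T); [rewrite ji | rewrite ij]; apply: fconnect1.
Qed.

Definition up_edge (i : 'I_n) : option (edge T) :=
  if i == root T then None else insub [set par T i; i].

Lemma up_edge_some (i : 'I_n) : i != root T ->
  exists2 e : edge T, val e = [set par T i; i] & up_edge i = Some e.
Proof.
move=> ir; rewrite /up_edge (negPf ir).
have ie : [set par T i; i] \in edges T.
  by apply/imsetP; exists i; rewrite ?inE.
by exists (Sub [set par T i; i] ie); rewrite ?SubK // insubT.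
Qed.

Lemma up_edge_surj (e : edge T) : exists2 i, i != root T & up_edge i = Some e.
Proof.
have /imsetP[i] := valP e; rewrite !inE => ir eE; exists i => //.
by have [e' e'E ->] := up_edge_some ir; congr Some; apply: val_inj; rewrite e'E eE.
Qed.

Lemma up_edge_uniq (i j : 'I_n) (e : edge T) :
  up_edge i = Some e -> up_edge j = Some e -> i = j.
Proof.
have nr (k : 'I_n) : up_edge k = Some e -> k != root T by rewrite /up_edge; case: eqP.
move=> ie je; have [ir jr] := (nr _ ie, nr _ je).
have [e1 e1E] := up_edge_some ir; rewrite ie => -[ee1].
have [e2 e2E] := up_edge_some jr; rewrite je => -[ee2].
by apply: edge_inj; rewrite ?inE // -e1E -e2E -ee1 -ee2.
Qed.

Lemma sum_edges (l : edge T -> nat) :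
  \sum_e l e = \sum_(i | i != root T) oapp l 0 (up_edge i).
Proof.
(* Extending [l] by 0 to all vertex sets allows reindexing along [edge_inj]. *)
pose g (s : {set 'I_n}) := oapp l 0 (insub s).
transitivity (\sum_(e : edge T) g (val e)).
  by apply: eq_bigr => e _; rewrite /g valK.
rewrite -(big_sub (edges T)) big_imset; last exact: edge_inj.
apply: eq_big => [i|i]; rewrite !inE // => ir.
by rewrite /up_edge (negPf ir).
Qed.

End EdgeLabels.

(** * Labels and root weight as digits *)

Section Digits.
Variables (n b : nat).
Implicit Types U : utree n b.

(** Labels are complemented because they stand opposite [rsum] in the identity, whereas the root
    weight stands beside it. *)
Definition digit U (i : 'I_n) : nat :=
  oapp (fun e => b.-1 - elabel U e) (rweight U) (up_edge U i).

Lemma digit_ltn U i : digit U i < b.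
Proof.
rewrite /digit; case: (up_edge U i) => [e|] /=; last exact: ltn_ord.
by have := ltn_ord (elabel U e); lia.
Qed.

Lemma digit_root U : digit U (root U) = rweight U.
Proof. by rewrite /digit /up_edge eqxx. Qed.

Lemma sum_digit U :
  \sum_i digit U i + \sum_e elabel U e = rweight U + n.-1 * b.-1.
Proof.
rewrite (bigD1 (root U)) //= digit_root -addnA; congr (_ + _).
rewrite sum_edges -big_split /=.
transitivity (\sum_(i | i != root U) b.-1).
  apply: eq_bigr => i /up_edge_some[e _ ie]; rewrite /digit ie /=.
  by case: (elabel U e) => x xb /=; lia.
rewrite sum_nat_const; congr (_ * _).
by have := cardC1 (root U); rewrite card_ord => <-; apply: eq_card.
Qed.

Lemma utree_eq U U' : tree U = tree U' -> digit U =1 digit U' -> U = U'.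
Proof.
case: U U' => [T u l w] [T' u' l' w'] /= TT'.
case: T' / TT' in u' l' *; rewrite (bool_irrelevance u' u) => dd'.
have -> : w' = w.
  by apply: val_inj; have := dd' (root T); rewrite !digit_root.
congr UTree; apply/ffunP=> e; have [i _ ie] := up_edge_surj e.
have := dd' i; rewrite /digit /= ie /= => h; apply: val_inj; move: h.
by case: (l e) (l' e) => [x xb] [y yb] /=; lia.
Qed.

Lemma utree_digits (T : rtree n) (d : 'I_n -> nat) : uprooted T ->
  (forall i, d i < b) -> exists2 U, tree U = T & digit U =1 d.
Proof.
move=> uT db; pose mk i : 'I_b := Ordinal (db i).
(* The complemented digit of the lower endpoint of [e]; the default is never reached, since every
   edge lies above some vertex. *)
pose l := [ffun e : edge T =>
  rev_ord (odflt (mk (root T)) (omap mk [pick i | up_edge T i == Some e]))].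
exists (UTree uT l (mk (root T))) => //= i; rewrite /digit /=.
have [->|/up_edge_some[e _ ie]] := eqVneq i (root T); first by rewrite /up_edge eqxx.
rewrite ie /= ffunE; case: pickP => [j /eqP je|/(_ i)]; last by rewrite ie eqxx.
by rewrite /= (up_edge_uniq je ie); have := db i; lia.
Qed.

End Digits.

(** Lets the bijection be given as a relation, with no formula for either map: both are chosen, and
    uniqueness makes them inverse. *)
Lemma bijective_of_rel (X Y : Type) (R : X -> Y -> Prop) :
  (forall x, exists y, R x y) -> (forall y, exists x, R x y) ->
  (forall x y y', R x y -> R x y' -> y = y') ->
  (forall x x' y, R x y -> R x' y -> x = x') ->
  exists f : X -> Y, bijective f /\ forall x, R x (f x).
Proof.
move=> xR yR Rr Rl.
pose f x := sval (constructive_indefinite_description _ (xR x)).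
pose g y := sval (constructive_indefinite_description _ (yR y)).
have fP x : R x (f x) := svalP (constructive_indefinite_description _ (xR x)).
have gP y : R (g y) y := svalP (constructive_indefinite_description _ (yR y)).
exists f; split=> //; exists g => [x|y]; first exact: Rl (gP _) (fP _).
exact: Rr (fP _) (gP _).
Qed.

(** * The correspondence between vectors and labelled trees *)

Section Correspondence.
Variables (n a b : nat).
Hypotheses (n1 : 1 < n) (b0 : 0 < b).
Implicit Types (P : 'X_{1..n}) (U : utree n b) (F : forest n).

Definition encodes P U F : Prop :=
  [/\ spans (root U) F, decr F, par U =1 fpar F (root U)
    & forall i, P i = a + (b * (if i == root U then 0 else code F i) + digit U i)].

Lemma encodes_quot P U F i : encodes P U F ->
  (P i - a) %/ b = (if i == root U then 0 else code F i).
Proof.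
case=> _ _ _ ->; rewrite addKn mulnC divnMDl // divn_small ?addn0 //.
exact: digit_ltn.
Qed.

Lemma encodes_digit P U F i : encodes P U F -> (P i - a) %% b = digit U i.
Proof.
by case=> _ _ _ ->; rewrite addKn mulnC modnMDl modn_small // digit_ltn.
Qed.

Lemma encodes_sPF (K : fieldType) P U F : encodes P U F ->
  sPF K (complete_multigraph n a b) P.
Proof.
move=> PUF; apply/sPF_complete => //; split=> [i|k kn].
  by case: PUF => _ _ _ ->; apply: leq_addr.
have [rF _ _ _] := PUF; have := forest_prime_parking rF kn.
by congr (_ < _); apply: eq_count => i /=; rewrite (encodes_quot _ PUF).
Qed.

Lemma sPF_encodes (K : fieldType) P : sPF K (complete_multigraph n a b) P ->
  exists U F, encodes P U F.
Proof.
case/(sPF_complete K a P n1 b0) => aP /(prime_parking_forest n1)[r [F [rF dF tF qF]]].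
have [T Tr TF] := forest_rtree rF; rewrite -Tr in rF TF tF qF.
have uT : uprooted T by rewrite (uprooted_forest rF TF).
have [U UT dU] := utree_digits uT (fun i => ltn_pmod (P i - a) b0).
exists U, F; rewrite /encodes UT; split=> // i.
by rewrite -qF dU mulnC -divn_eq subnKC.
Qed.

Lemma utree_encodes U : exists P F, encodes P U F.
Proof.
have [F [rF dF fF]] := rtree_forest U.
exists [multinom a + (b * (if i == root U then 0 else code F i) + digit U i) | i < n], F.
by split=> // i; rewrite mnmE.
Qed.

(** The root of [U] has quotient 0, so it is the root of [U'] or a zero of [code F']; since [U'] is
    uprooted, such zeros are below [root U']. *)
Lemma encodes_root P U F U' F' : encodes P U F -> encodes P U' F' ->
  root U <= root U'.
Proof.
move=> PUF PUF'; have [rF' _ fF' _] := PUF'.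
have := encodes_quot (root U) PUF'; rewrite (encodes_quot _ PUF) eqxx.
case: eqVneq => [->//|ne] /esym c0; apply: ltnW.
have := tree_uprooted U'; rewrite (uprooted_forest rF' fF').
by move/tops_ltn_zero; apply; rewrite ?(spans_mem _ rF').
Qed.

(** Quotients fix the root and, through [code_inj], the forest; remainders fix the labels and the
    weight. *)
Lemma encodes_utree_uniq P U F U' F' : encodes P U F -> encodes P U' F' -> U = U'.
Proof.
move=> PUF PUF'.
have rr' : root U = root U'.
  by apply/val_inj/eqP; rewrite eqn_leq (encodes_root PUF PUF') (encodes_root PUF' PUF).
have [[rF dF fF _] [rF' dF' fF' _]] := (PUF, PUF').
have FF' : F = F'.
  apply: code_inj (spans_uniq rF) (spans_uniq rF') dF dF' _ _ => i.
    by rewrite (spans_mem _ rF) (spans_mem _ rF') rr'.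
  rewrite (spans_mem _ rF) => ir.
  have := encodes_quot i PUF'; rewrite (encodes_quot i PUF) -rr' (negPf ir) //.
apply: utree_eq => [|i]; last by rewrite -(encodes_digit i PUF) (encodes_digit i PUF').
by apply: rtree_eq => // i; rewrite fF fF' FF' rr'.
Qed.

Lemma encodes_vector_uniq P F P' F' U : encodes P U F -> encodes P' U F' -> P = P'.
Proof.
move=> [rF dF fF PE] [rF' dF' fF' PE']; apply/mnmP=> i.
by rewrite PE PE' (rtree_forest_uniq rF rF' dF dF' fF fF').
Qed.

(** With [n = m.+1], [sum_code] leaves [kappa] and [b * m] from the genus term [b * 'C(n, 2)];
    [sum_digit] absorbs [m * b.-1], and [m - n] accounts for the 1 in the identity. *)
Lemma encodes_rsum P U F : encodes P U F ->
  (rsum (complete_multigraph n a b) P + (rweight U)%:Z + 1 =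
   (kappa (del_root (complete_multigraph n a b)) U)%:Z
   + (\sum_(e : edge U) elabel U e)%N%:Z)%R.
Proof.
move=> [rF dF fF PE]; rewrite /rsum /genus nedges_complete (kappa_forest _ _ rF fF).
have sP : \sum_(i < n) P i =
    a * n + (b * \sum_(i <- nodes F) code F i + \sum_i digit U i).
  rewrite (eq_bigr _ (fun i _ => PE i)) !big_split /= -big_distrr /=.
  rewrite sum_nat_const card_ord mulnC; congr (_ + (b * _ + _)).
  rewrite -big_enum -(perm_big _ rF) /= big_cons eqxx add0n.
  by apply: eq_big_seq => i; rewrite (spans_mem _ rF) => /negPf ->.
have := sum_code (spans_uniq rF); have := sum_digit U; have := spans_size rF.
rewrite {}sP; move: (size (nodes F)) => m mn.
have -> : 'C(n, 2) = 'C(m, 2) + m by rewrite -mn binS bin1.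
have -> : n.-1 = m by rewrite -mn.
move: (\sum_(i <- _) _) (\sum_i _) (\sum_e _) (forest_inv F) 'C(m, 2) => s d l v c hd hc.
(* Expanding the products leaves a linear identity; [0 < b] gives [b * m = m + m * b.-1]. *)
have hb : b * (c + m) = b * s + b * v + (m + m * b.-1).
  by rewrite -hc !mulnDr; case: b b0 => // b' _; lia.
lia.
Qed.

End Correspondence.

Import Order.TTheory GRing.Theory Num.Theory.
Local Open Scope ring_scope.

Theorem theorem2p11 (K : fieldType) (n a b : nat)
    (hn : (2 <= n)%N) (ha : (1 <= a)%N) (hb : (1 <= b)%N) :
  exists phi : {P : 'X_{1..n} | sPF K (complete_multigraph n a b) P} -> utree n b,
    bijective phi /\
    forall P : {P : 'X_{1..n} | sPF K (complete_multigraph n a b) P},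
      rsum (complete_multigraph n a b) (sval P) + (rweight (phi P))%:Z + 1 =
      (kappa (del_root (complete_multigraph n a b)) (phi P))%:Z
      + (\sum_(e : edge (phi P)) elabel (phi P) e)%N%:Z.
Proof.
pose R (P : {P : 'X_{1..n} | sPF K (complete_multigraph n a b) P}) (U : utree n b) :=
  exists F, encodes a (sval P) U F.
have [||||phi [phi_bij phiR]] := @bijective_of_rel _ _ R.
- by case=> P sP; apply: sPF_encodes sP.
- move=> U; have [P [F PUF]] := utree_encodes a U.
  by exists (exist _ P (encodes_sPF hn hb K PUF)), F.
- by move=> P U U' [F PUF] [F' PUF']; apply: encodes_utree_uniq PUF PUF'.
- move=> [P sP] [P' sP'] U [F PUF] [F' PUF'].
  have /= PP' := encodes_vector_uniq PUF PUF'; case: P' / PP' in sP' {PUF'} *.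
  (* [sPF] is a proposition, so equal vectors give equal elements of the subtype by proof
     irrelevance. *)
  by congr exist; apply: proof_irrelevance.
exists phi; split=> // P; have [F PUF] := phiR P.
exact: encodes_rsum PUF.
Qed.
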